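(* Let $R$ be a commutative ring with identity. The irreducible components of $QPrim(R)$ are the closed sets $V_q(Q)$, where $Q\in QPrim(R)$ is such that $\sqrt{Q}$ is a minimal prime ideal of $R$.
   Context: An ideal $I$ of $R$ is quasi-primary if its radical $\sqrt{I}$ is a prime ideal; $QPrim(R)$ denotes the set of all quasi-primary ideals of $R$. It carries the Zariski topology, whose closed sets are the sets $V_q(I)=\{Q\in QPrim(R): I\subseteq \sqrt{Q}\}$ for ideals $I$ of $R$. A topological space is irreducible if it is nonempty and cannot be written as a union of two proper closed subsets. The irreducible components of a topological space $X$ are the maximal irreducible subsets of $X$. *)

(* Defs.v *)
From HB Require Import structures.
From mathcomp Require Import all_boot all_order all_algebra.
From mathcomp Require Import all_classical topology.

Set Implicit Arguments.
Unset Strict Implicit.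
Unset Printing Implicit Defensive.

Import GRing.Theory.
Local Open Scope classical_set_scope.
Local Open Scope ring_scope.

(* Ideals are [set]s, not instances of MathComp's [idealr], because [idealr]
   only covers proper ideals of nontrivial rings. *)
Section Ideals.
Variable R : comPzRingType.
Implicit Types (I J P Q : set R).

Definition is_ideal I : Prop :=
  [/\ I 0,
      forall x y, I x -> I y -> I (x + y)
    & forall a x, I x -> I (a * x)].

Definition prime_ideal P : Prop :=
  [/\ is_ideal P,
      ~ P 1
    & forall x y, P (x * y) -> P x \/ P y].

Definition minimal_prime P : Prop :=
  prime_ideal P /\ forall P', prime_ideal P' -> P' `<=` P -> P' = P.

Definition radical I : set R := [set x | exists n : nat, I (x ^+ n.+1)].

Definition quasi_primary Q : Prop := is_ideal Q /\ prime_ideal (radical Q).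

Record QPrim : Type := MkQPrim {
  qideal :> set R;
  qidealP : quasi_primary qideal }.

Definition Vq I : set QPrim := [set Q : QPrim | I `<=` radical Q].

Definition zariski_open (U : set QPrim) : Prop :=
  exists I, is_ideal I /\ U = ~` Vq I.

Lemma radical_ideal (Q : QPrim) : is_ideal (radical Q).
Proof. by case: (qidealP Q) => _ []. Qed.

Lemma zariski_openT : zariski_open setT.
Proof.
exists setT; split; first by split.
apply/seteqP; split=> // Q _ /(_ 1 Logic.I).
by case: (qidealP Q) => _ [].
Qed.

Lemma zariski_openI : setI_closed zariski_open.
Proof.
move=> _ _ [I [[I0 ID IM] ->]] [J [[J0 JD JM] ->]].
exists (I `&` J); split.
  split; first by split.
  - by move=> x y [? ?] [? ?]; split; [apply: ID | apply: JD].
  - by move=> a x [? ?]; split; [apply: IM | apply: JM].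
rewrite -setCU; congr (~` _); apply/seteqP; split=> Q.
  by case=> h x [Ix Jx]; apply: h.
move=> h; apply: contrapT => /not_orP [/existsNP [x /not_implyP [Ix nx]]].
move=> /existsNP [y /not_implyP [Jy ny]].
have [_ [_ _ /(_ x y)]] := qidealP Q.
by case=> //; apply: h; split; [rewrite mulrC; apply: IM | apply: JM].
Qed.

Lemma zariski_open_bigU (K : Type) (f : K -> set QPrim) :
  (forall k, zariski_open (f k)) -> zariski_open (\bigcup_k f k).
Proof.
move=> /choice [J JP].
pose G : set R :=
  [set x | forall A, is_ideal A -> (forall k, J k `<=` A) -> A x].
exists G; split.
  split; first by move=> A [].
  - move=> x y Gx Gy A iA JA; case: (iA) => _ AD _.
    by apply: AD; [apply: Gx | apply: Gy].
  - by move=> a x Gx A iA JA; case: (iA) => _ _ AM; apply: AM; apply: Gx.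
apply/seteqP; split=> Q.
  case=> k _; have [_ ->] := JP k; apply: contra_not => GQ x Jx.
  by apply: GQ => A _ JA; apply: JA Jx.
apply: contra_notP => nf x Gx; apply: (Gx _ (radical_ideal Q)) => k y Jy.
apply: contrapT => ny; apply: nf; exists k => //.
by have [_ ->] := JP k => /(_ y Jy).
Qed.

End Ideals.

HB.instance Definition _ (R : comPzRingType) := gen_eqMixin (QPrim R).
HB.instance Definition _ (R : comPzRingType) := gen_choiceMixin (QPrim R).
HB.instance Definition _ (R : comPzRingType) :=
  isOpenTopological.Build (QPrim R)
    (@zariski_openT R) (@zariski_openI R) (@zariski_open_bigU R).

Lemma zariski_closedP (R : comPzRingType) (C : set (QPrim R)) :
  closed C <-> exists I, is_ideal I /\ C = Vq I.
Proof.
rewrite -openC; split=> -[I [iI e]]; exists I; split=> //.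
  by rewrite -(setCK C) e setCK.
by rewrite e.
Qed.

Definition irreducible_space (X : topologicalType) : Prop :=
  [set: X] !=set0 /\
  ~ exists F G : set X, [/\ closed F, closed G, F <> setT, G <> setT
                          & F `|` G = setT].

(* [set_type A] carries the topology induced on [A] by [X]. *)
Definition irreducible_subset (X : topologicalType) (A : set X) : Prop :=
  irreducible_space (set_type A).

Definition irreducible_component (X : topologicalType) (A : set X) : Prop :=
  irreducible_subset A /\
  forall B : set X, irreducible_subset B -> A `<=` B -> B = A.

(* Main.v *)
Require Import Defs.
From mathcomp Require Import all_boot all_order all_algebra.
From mathcomp Require Import all_classical topology.

(** In any space the closure of a point is irreducible.  In [QPrim R] the
    closure of [Q] is [Vq Q], which depends on [Q] only through its radical, so
    every [Vq Q] is irreducible.  Conversely, if [A] is irreducible, the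
    intersection [P] of the radicals of its members is prime: when [x * y] lies
    in [P], the closed sets of points whose radicals contain [x], respectively
    [y], cover [A], hence one of them contains [A].  Being prime, [P] is itself
    a point of [QPrim R], and [A] is contained in the closure [Vq P].

    Therefore every irreducible subset lies in some [Vq P] with [P] prime, and
    the components are the maximal sets of this form
    ([irreducible_sub_Vq_prime]).  As [Vq P] is contained in [Vq P'] exactly
    when [P'] is contained in [P], maximality of [Vq P] is minimality of [P]. *)

Import GRing.Theory.
Local Open Scope classical_set_scope.
Local Open Scope ring_scope.

(** Irreducibility of a subspace can be tested with the closed sets of the
    ambient space, because the closed sets of the subspace are their traces. *)
Lemma irreducible_subsetP (X : topologicalType) (A : set X) :
  irreducible_subset A <->
  A !=set0 /\ forall F G : set X, closed F -> closed G ->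
    A `<=` F `|` G -> A `<=` F \/ A `<=` G.
Proof.
have trace_full (F : set X) :
    (set_val : A -> X) @^-1` F = setT <-> A `<=` F.
  split=> [/seteqP[_ FT] x Ax | AF].
    exact: (FT (SigSub (mem_set Ax)) Logic.I).
  by apply/seteqP; split=> // x _; apply: AF; exact: set_valP.
split=> [[[x _] irrA]|[[a Aa] irrA]].
  split; first by exists (set_val x); exact: set_valP.
  move=> F G cF cG AFG; apply: contrapT => /not_orP[nF nG]; apply: irrA.
  have trace_closed (H : set X) :
      closed H -> closed ((set_val : A -> X) @^-1` H).
    by move=> cH; apply: preimage_closed cH => y _; exact: initial_continuous.
  exists (set_val @^-1` F), (set_val @^-1` G); split.
  - exact: trace_closed.
  - exact: trace_closed.
  - by move/trace_full.
  - by move/trace_full.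
  - by rewrite -preimage_setU; exact/trace_full.
split; first by exists (SigSub (mem_set Aa)).
have closed_trace (H : set A) :
    closed H -> exists2 F : set X, closed F & H = set_val @^-1` F.
  rewrite -openC => -[U oU UH]; exists (~` U); first exact: open_closedC.
  by rewrite -[RHS]/(~` (set_val @^-1` U)) UH setCK.
move=> [_ [_ [/closed_trace[F cF ->] /closed_trace[G cG ->] nF nG]]].
rewrite -preimage_setU => /trace_full /(irrA _ _ cF cG).
by case=> /trace_full.
Qed.

Lemma prime_radical (R : comPzRingType) (P : set R) :
  prime_ideal P -> radical P = P.
Proof.
move=> [_ P1 PM]; apply/seteqP; split=> [x [n]|x Px]; last by exists 0%N.
elim: n => [|n IH]; first by rewrite expr1.
by rewrite exprS => /PM [].
Qed.

Lemma prime_quasi_primary (R : comPzRingType) (P : set R) :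
  prime_ideal P -> quasi_primary P.
Proof. by move=> pP; split; [case: pP | rewrite prime_radical]. Qed.

Section ZariskiTopology.
Variable R : comPzRingType.
Implicit Types (I J P : set R) (Q : QPrim R).

Lemma prime_radicalQ Q : prime_ideal (radical Q).
Proof. by case: (qidealP Q). Qed.

Lemma sub_radical I : I `<=` radical I.
Proof. by move=> x Ix; exists 0%N. Qed.

Lemma radical_sub_prime I P : prime_ideal P -> I `<=` P -> radical I `<=` P.
Proof.
move=> pP IP x [n Ix]; rewrite -(prime_radical _ _ pP).
by exists n; exact: IP.
Qed.

Lemma mem_Vq_self Q : Vq Q Q.
Proof. exact: sub_radical. Qed.

(** The defining inclusions have prime right-hand sides, and a prime contains
    [I] exactly when it contains [radical I]. *)
Lemma Vq_radical I : Vq (radical I) = Vq I.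
Proof.
apply/seteqP; split=> Q /=; first by apply: subset_trans; exact: sub_radical.
exact: radical_sub_prime (prime_radicalQ Q).
Qed.

Lemma subset_Vq I J : I `<=` J -> Vq J `<=` Vq I.
Proof. by move=> IJ Q /= JQ x /IJ; exact: JQ. Qed.

(** [Vq Q] is the closure of the point [Q], so whichever of two closed sets
    contains [Q] already contains all of [Vq Q]. *)
Lemma irreducible_Vq Q : irreducible_subset (Vq Q).
Proof.
have closure_point (F : set (QPrim R)) : closed F -> F Q -> Vq Q `<=` F.
  by move=> /zariski_closedP[I [_ ->]] /= IQ; rewrite -Vq_radical; exact: subset_Vq.
apply/irreducible_subsetP; split; first by exists Q; exact: mem_Vq_self.
move=> F G cF cG /(_ Q (mem_Vq_self Q)) [FQ|GQ].
  by left; exact: closure_point.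
by right; exact: closure_point.
Qed.

(** The basic closed sets; they are the [Vq] of principal ideals. *)
Lemma closed_mem_radical (x : R) : closed [set Q : QPrim R | radical Q x].
Proof.
apply/zariski_closedP; exists [set a * x | a in setT]; split.
  split; first by exists 0; rewrite ?mul0r.
  - by move=> _ _ [a _ <-] [b _ <-]; exists (a + b); rewrite ?mulrDl.
  - by move=> c _ [a _ <-]; exists (c * a); rewrite ?mulrA.
apply/seteqP; split=> Q /=; last by apply; exists 1; rewrite ?mul1r.
have [_ _ QM] := radical_ideal Q.
by move=> Qx _ [a _ <-]; exact: QM.
Qed.

Lemma irreducible_sub_Vq_prime (A : set (QPrim R)) :
  irreducible_subset A -> exists2 P, prime_ideal P & A `<=` Vq P.
Proof.
move=> /irreducible_subsetP[[Q0 AQ0] irrA].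
exists (\bigcap_(Q in A) radical Q); last by move=> Q AQ x; apply.
split.
- split.
  + by move=> Q _; case: (radical_ideal Q).
  + move=> x y Px Py Q AQ; have [_ QD _] := radical_ideal Q.
    by apply: QD; [exact: Px | exact: Py].
  + move=> a x Px Q AQ; have [_ _ QM] := radical_ideal Q.
    by apply: QM; exact: Px.
- by move=> /(_ Q0 AQ0); case: (prime_radicalQ Q0).
- move=> x y Pxy.
  have := irrA _ _ (closed_mem_radical x) (closed_mem_radical y).
  apply=> Q AQ; have [_ _ QM] := prime_radicalQ Q.
  by apply: QM; exact: Pxy.
Qed.

End ZariskiTopology.

Theorem theorem2p12 (R : comPzRingType) :
  [set C : set (QPrim R) | irreducible_component C] =
  [set Vq (qideal Q) | Q in [set Q : QPrim R | minimal_prime (radical (qideal Q))]].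
Proof.
apply/seteqP; split=> [C [irrC maxC]|_ [Q [_ minQ] <-]] /=.
  have [P pP CP] := irreducible_sub_Vq_prime _ _ irrC.
  pose QP P' (pP' : prime_ideal P') := MkQPrim (prime_quasi_primary R P' pP').
  have CE : Vq P = C := maxC _ (irreducible_Vq _ (QP P pP)) CP.
  exists (QP P pP) => //=.
  rewrite (prime_radical _ _ pP); split=> // P' pP' P'P.
  have VE : Vq P' = C.
    apply: maxC (irreducible_Vq _ (QP P' pP')) _.
    by rewrite -CE; exact: subset_Vq.
  (* The point [P'] lies in [Vq P' = Vq P], so [P] is contained in [P']. *)
  have := mem_Vq_self _ (QP P' pP'); rewrite /= VE -CE /Vq /=.
  by rewrite (prime_radical _ _ pP') => PP'; apply/seteqP.
split; first exact: irreducible_Vq.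
move=> B irrB QB; apply/seteqP; split=> //.
have [P pP BP] := irreducible_sub_Vq_prime _ _ irrB.
have PQ : P `<=` radical Q by apply: BP; apply: QB; exact: mem_Vq_self.
by rewrite -(Vq_radical R Q) -(minQ P pP PQ).
Qed.
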